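(* The number of chip configurations reachable from the initial configuration $(c,0,0)$ on the triangle graph $C_3$ is equal to the number of chip configurations debt-reachable from $(c,0,0)$ when $c$ is not divisible by $3$, and is $2$ less than the number of chip configurations debt-reachable from $(c,0,0)$ when $c$ is divisible by $3$. Explicitly, the number of chip configurations reachable from $(c,0,0)$ equals $$\frac{3k^2+3k-2}{2}\ \text{ if } c=3k,\qquad \frac{3k^2+5k+2}{2}\ \text{ if } c=3k+1,\qquad \frac{3k^2+7k+4}{2}\ \text{ if } c=3k+2.$$
   Context: $C_3$ is the cycle graph on vertices $1,2,3$ (every vertex has degree $2$ and is adjacent to the other two). A chip configuration on a graph with vertices $1,\dots,n$ is an $n$-tuple of nonnegative integers $(c_1,\dots,c_n)$, with $c_i$ the number of chips on vertex $i$. Firing vertex $i$, of degree $d_i$, subtracts $d_i$ chips from vertex $i$ and adds one chip to each vertex adjacent to $i$. The firing is a legal chip-firing move if vertex $i$ has at least $d_i$ chips before the move; a general chip-firing move is a firing with no such condition imposed (so tuples may acquire negative entries). A chip configuration $C'$ is reachable (resp. debt-reachable) from a chip configuration $C$ if some finite (possibly empty) sequence of legal (resp. general) chip-firing moves transforms $C$ into $C'$; both $C$ and $C'$ must have nonnegative entries. In the formulas, $k$ is an integer.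
   Formalization: The formal theorem assumes c > 0: for c = 0 the statement fails, since exactly one configuration is reachable and one is debt-reachable from (0,0,0), so ''2 less'' is false and the formula for c = 3k gives −1 at k = 0. *)

(* Defs.v *)
From HB Require Import structures.
From Stdlib Require Import Relation_Operators.
From mathcomp Require Import all_boot all_order all_algebra.
From mathcomp Require Import finmap boolp classical_sets cardinality.
Set Implicit Arguments.
Unset Strict Implicit.
Unset Printing Implicit Defensive.
Import Order.TTheory GRing.Theory Num.Theory.
Local Open Scope ring_scope.
Local Open Scope classical_set_scope.

(* A simple graph is its adjacency relation [e : rel V] on a finite vertex type. *)

Section ChipFiring.
Variables (V : finType) (e : rel V).
Implicit Types (C : {ffun V -> int}) (i : V).

Definition deg i : nat := #|[pred j | e i j]|.

(* General moves may produce negative entries, so moves act on integer tuples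
   and nonnegativity is a separate predicate. *)
Definition chip_config C : Prop := forall i, 0 <= C i.

Definition fire C i : {ffun V -> int} :=
  [ffun j => if j == i then C j - (deg i)%:Z else C j + (e i j)%:Z].

Definition legal_move C C' : Prop :=
  exists i, (deg i)%:Z <= C i /\ C' = fire C i.

Definition general_move C C' : Prop := exists i, C' = fire C i.

Definition reachable C C' : Prop :=
  [/\ chip_config C, chip_config C' & clos_refl_trans _ legal_move C C'].

(* Intermediate tuples are unconstrained; only the endpoints are configurations. *)
Definition debt_reachable C C' : Prop :=
  [/\ chip_config C, chip_config C' & clos_refl_trans _ general_move C C'].

Definition reachable_set C : set {ffun V -> int} := [set C' | reachable C C'].

Definition debt_reachable_set C : set {ffun V -> int} :=
  [set C' | debt_reachable C C'].

End ChipFiring.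

(* [fset_set A] is empty when [A] is infinite, so [number_of A] is the number of
   elements of [A] only if [finite_set A]. *)
Definition number_of (T : choiceType) (A : set T) : nat := #|` fset_set A|%fset.

(* The cycle on n vertices, for n >= 3; [ordS] is the cyclic successor. *)
Definition cycle_graph (n : nat) : rel 'I_n :=
  [rel i j | (j == ordS i) || (i == ordS j)].

Definition C3 : rel 'I_3 := @cycle_graph 3.

Lemma C3E (i j : 'I_3) : C3 i j = (i != j).
Proof. by case: i j => [[|[|[|i]]] ?] [[|[|[|j]]] ?]. Qed.

Lemma deg_C3 (i : 'I_3) : deg C3 i = 2%N.
Proof.
have -> : deg C3 i = #|predC1 i|.
  by apply: eq_card => j; rewrite !inE C3E eq_sym.
by have := cardC1 i; rewrite card_ord.
Qed.

Definition initial (c : nat) : {ffun 'I_3 -> int} :=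
  [ffun i => if i == ord0 then c%:Z else 0].

(* Main.v *)
Require Import Defs.
From Stdlib Require Import Relation_Operators.
From mathcomp Require Import all_boot all_order all_algebra.
From mathcomp Require Import finmap boolp classical_sets cardinality.
From mathcomp Require Import zify ring.
Set Implicit Arguments.
Unset Strict Implicit.
Unset Printing Implicit Defensive.
Import Order.TTheory GRing.Theory Num.Theory.
Local Open Scope ring_scope.
Local Open Scope classical_set_scope.

(** Write a tuple on the triangle as (x, y, z).  Every firing preserves the sum
    x + y + z and the residue of y - z modulo 3, so all configurations
    debt-reachable from (c, 0, 0) are of the form (c - y - z, y, z) with
    y + z <= c and y = z modulo 3 ([general_moves_invariant]).  Along legal
    moves there is one more obstruction: after vertex 0 fires, vertices 1 and 2
    both hold a chip, and after vertex 1 or 2 fires, vertex 0 holds one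
    ([legal_moves_occupied]).  This excludes (0, c, 0) and (0, 0, c), which
    satisfy the congruence exactly when 3 divides c.

    These are the only obstructions.  Undoing legal moves, one walks from
    (x, y, z) back to (c, 0, 0): if y and z are positive, undo a firing of
    vertex 0; if z = 0, then y is a multiple of 3, and, as soon as x and y are
    positive, undoing one firing of vertex 2 and two of vertex 0 leads to
    (x + 3, y - 3, 0); the case y = 0 is symmetric ([legal_moves_complete]).
    With general moves the same three firings also lead from (3, c - 3, 0) to
    (0, c, 0), so that this configuration and its mirror image are reached as
    well ([general_moves_complete]).

    It remains to count the pairs (y, z).  Adding up over the diagonals
    y + z = s <= c, their total number T satisfies
    6 T = (c + 1)(c + 2) + 4 [3 | c] ([size_balanced_pairs]); after
    removing the two excluded pairs when 3 divides c, this gives the three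
    quadratic formulas. *)

(** * Firings on the triangle *)

Definition config (x y z : int) : {ffun 'I_3 -> int} :=
  [ffun i => nth 0 [:: x; y; z] (nat_of_ord i)].

Definition v0 : 'I_3 := ord0.
Definition v1 : 'I_3 := inord 1.
Definition v2 : 'I_3 := ord_max.

Lemma C3_vertexP (P : 'I_3 -> Prop) : P v0 -> P v1 -> P v2 -> forall i, P i.
Proof.
move=> P0 P1 P2 [[|[|[|//]]] lt_i3].
- by rewrite (_ : Ordinal _ = v0) //; apply: val_inj.
- by rewrite (_ : Ordinal _ = v1) //; apply: val_inj; rewrite /= inordK.
- by rewrite (_ : Ordinal _ = v2) //; apply: val_inj.
Qed.

Lemma configE x y z :
  (config x y z v0 = x) * (config x y z v1 = y) * (config x y z v2 = z).
Proof. by rewrite /config !ffunE /= inordK. Qed.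

Lemma config_eta (C : {ffun 'I_3 -> int}) : C = config (C v0) (C v1) (C v2).
Proof. by apply/ffunP; apply: C3_vertexP; rewrite configE. Qed.

Lemma initialE (c : nat) : initial c = config c 0 0.
Proof.
apply/ffunP; apply: C3_vertexP; rewrite configE ffunE //.
by rewrite -val_eqE /= inordK.
Qed.

Lemma fire_C3 x y z :
  (fire C3 (config x y z) v0 = config (x - 2) (y + 1) (z + 1)) *
  (fire C3 (config x y z) v1 = config (x + 1) (y - 2) (z + 1)) *
  (fire C3 (config x y z) v2 = config (x + 1) (y + 1) (z - 2)).
Proof.
have v1E : v1 = 1%N :> nat by rewrite /= inordK.
by do !split; apply/ffunP; apply: C3_vertexP;
   rewrite configE /fire ffunE deg_C3 C3E -!val_eqE /= ?v1E /= configE.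
Qed.

Lemma chip_config_config x y z :
  chip_config (config x y z) <-> [/\ 0 <= x, 0 <= y & 0 <= z].
Proof.
split=> [pos | [x_ge0 y_ge0 z_ge0]]; last by apply: C3_vertexP; rewrite configE.
by have := (pos v0, pos v1, pos v2); rewrite !configE => -[[]].
Qed.

(** * Invariants *)

Local Notation general_moves := (clos_refl_trans _ (general_move C3)).
Local Notation legal_moves := (clos_refl_trans _ (legal_move C3)).

Lemma legal_moves_general C C' : legal_moves C C' -> general_moves C C'.
Proof.
elim=> {C C'} [C C' [i [_ ->]] | C | C1 C2 C3' _ IH1 _ IH2].
- by apply: rt_step; exists i.
- exact: rt_refl.
- exact: rt_trans IH1 IH2.
Qed.

Lemma general_moves_invariant C C' : general_moves C C' ->
  C' v0 + C' v1 + C' v2 = C v0 + C v1 + C v2 /\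
  exists q, C' v1 - C' v2 = C v1 - C v2 + 3 * q.
Proof.
elim=> {C C'} [C _ [i ->] | C | C1 C2 C3' _ [s1 [q1 e1]] _ [s2 [q2 e2]]].
- rewrite (config_eta C); move: (C v0) (C v1) (C v2) => x y z.
  move: i; apply: C3_vertexP; rewrite fire_C3 !configE; split; try lia.
  + by exists 0; lia.
  + by exists (-1); lia.
  + by exists 1; lia.
- by split=> //; exists 0; rewrite mulr0 addr0.
- by split; [rewrite s2 | exists (q1 + q2); rewrite e2 e1 -addrA mulrDr].
Qed.

Definition occupied (C : {ffun 'I_3 -> int}) : Prop :=
  0 < C v0 \/ 0 < C v1 /\ 0 < C v2.

(** A firing gives a chip to each neighbour of the fired vertex, and those are
    the two other vertices. *)
Lemma legal_moves_occupied C C' : legal_moves C C' ->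
  chip_config C -> occupied C -> chip_config C' /\ occupied C'.
Proof.
move=> moves C_ge0 C_occ.
elim: moves C_ge0 C_occ => {C C'} [C _ [i [+ ->]] | // | C1 C2 C3' _ IH1 _ IH2].
- rewrite deg_C3 (config_eta C); move: (C v0) (C v1) (C v2) => x y z.
  move=> deg_le /chip_config_config[x_ge0 y_ge0 z_ge0] _; move: i deg_le.
  apply: C3_vertexP; rewrite fire_C3 /occupied chip_config_config !configE;
    by move=> deg_le; split; [split; lia | lia].
- by move=> C1_ge0 /(IH1 C1_ge0)[C2_ge0 /(IH2 C2_ge0)].
Qed.

(** * Completeness of the invariants *)

Lemma general_fire C C' i :
  general_moves C C' -> general_moves C (fire C3 C' i).
Proof. by move=> moves; apply: rt_trans moves _; apply: rt_step; exists i. Qed.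

Lemma legal_fire C C' i :
  legal_moves C C' -> 2 <= C' i -> legal_moves C (fire C3 C' i).
Proof.
move=> moves C'_i; apply: rt_trans moves _.
by apply: rt_step; exists i; rewrite deg_C3.
Qed.

(** Firing vertex 0 twice moves four chips, two to each neighbour; firing the
    neighbour that was empty clears it again and gives one chip to each of the
    other two vertices. *)
Lemma transfer3E x y :
  (config x (y + 3) 0 =
     fire C3 (fire C3 (fire C3 (config (x + 3) y 0) v0) v0) v2) *
  (config x 0 (y + 3) =
     fire C3 (fire C3 (fire C3 (config (x + 3) 0 y) v0) v0) v1).
Proof. by rewrite !fire_C3; split; congr config; lia. Qed.

Lemma general_transfer3 x y :
  general_moves (config (x + 3) y 0) (config x (y + 3) 0) /\
  general_moves (config (x + 3) 0 y) (config x 0 (y + 3)).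
Proof.
by rewrite !transfer3E; split; do 3!apply: general_fire; apply: rt_refl.
Qed.

(** Vertex 0 holds x + 1 chips when it fires for the second time, hence the
    condition on x. *)
Lemma legal_transfer3 x y : 0 < x ->
  legal_moves (config (x + 3) y 0) (config x (y + 3) 0) /\
  legal_moves (config (x + 3) 0 y) (config x 0 (y + 3)).
Proof.
by move=> x_gt0; rewrite !transfer3E; split;
   do 3![apply: legal_fire; last by rewrite ?fire_C3 configE; lia];
   apply: rt_refl.
Qed.

(** Undoing the last move, or the last three moves, decreases y + z and leaves
    vertex 0 occupied, so that the induction hypothesis applies. *)
Lemma legal_moves_complete (x y z : nat) :
  y = z %[mod 3] -> (0 < x)%N || (0 < y)%N && (0 < z)%N ->
  legal_moves (config (x + y + z)%N 0 0) (config x y z).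
Proof.
have [n] := ubnP (y + z)%N.
elim: n x y z => // n IHn x [|y] [|z] le_n yz occ.
- by rewrite !addn0; apply: rt_refl.
(* When y = 0, the positive z is a multiple of 3, so at least 3. *)
- have [m def_z] : exists m, z = m.+2 by exists (z - 2)%N; lia.
  have x_gt0 : (0 < x)%N by lia.
  rewrite {z}def_z in le_n yz occ *.
  have [_ last_moves] := @legal_transfer3 x m x_gt0.
  rewrite (_ : m.+3%:Z = m%:Z + 3); last by lia.
  apply: rt_trans last_moves; rewrite (_ : x%:Z + 3 = x.+3); last by lia.
  rewrite (_ : x + 0 + m.+3 = x.+3 + 0 + m)%N; last by lia.
  by apply: IHn; lia.
- have [m def_y] : exists m, y = m.+2 by exists (y - 2)%N; lia.
  have x_gt0 : (0 < x)%N by lia.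
  rewrite {y}def_y in le_n yz occ *.
  have [last_moves _] := @legal_transfer3 x m x_gt0.
  rewrite (_ : m.+3%:Z = m%:Z + 3); last by lia.
  apply: rt_trans last_moves; rewrite (_ : x%:Z + 3 = x.+3); last by lia.
  rewrite (_ : x + m.+3 + 0 = x.+3 + m + 0)%N; last by lia.
  by apply: IHn; lia.
- have -> : config x y.+1 z.+1 = fire C3 (config x.+2 y z) v0.
    by rewrite fire_C3; congr config; lia.
  apply: legal_fire; last by rewrite configE; lia.
  rewrite (_ : x + y.+1 + z.+1 = x.+2 + y + z)%N; last by lia.
  by apply: IHn; lia.
Qed.

(** The two configurations excluded by the legality constraint are one transfer
    away from a legally reachable one. *)
Lemma general_moves_complete (x y z : nat) :
  y = z %[mod 3] -> general_moves (config (x + y + z)%N 0 0) (config x y z).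
Proof.
move=> yz.
have [occ|] := boolP ((0 < x)%N || (0 < y)%N && (0 < z)%N).
  exact/legal_moves_general/legal_moves_complete.
case: x y z yz => [|//] [|y] [|z] //= yz _.
- exact: rt_refl.
- have [m def_z] : exists m, z = m.+2 by exists (z - 2)%N; lia.
  rewrite {z}def_z in yz *.
  have [_] := general_transfer3 0 m.
  rewrite (_ : m%:Z + 3 = m.+3); last by lia.
  apply: rt_trans; apply: legal_moves_general.
  have -> : (0 + 0 + m.+3 = 3 + 0 + m)%N by lia.
  by apply: legal_moves_complete; lia.
- have [m def_y] : exists m, y = m.+2 by exists (y - 2)%N; lia.
  rewrite {y}def_y in yz *.
  have [+ _] := general_transfer3 0 m.
  rewrite (_ : m%:Z + 3 = m.+3); last by lia.
  apply: rt_trans; apply: legal_moves_general.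
  have -> : (0 + m.+3 + 0 = 3 + m + 0)%N by lia.
  by apply: legal_moves_complete; lia.
Qed.

(** * Balanced pairs *)

Definition balanced_diagonal (s : nat) : seq nat :=
  [seq z <- iota 0 s.+1 | s - z == z %[mod 3]].

Definition balanced_pairs (c : nat) : seq (nat * nat) :=
  [seq ((s - z)%N, z) | s <- iota 0 c.+1, z <- balanced_diagonal s].

Lemma mem_balanced_pairs c y z :
  ((y, z) \in balanced_pairs c) = (y + z <= c)%N && (y == z %[mod 3]).
Proof.
apply/allpairsPdep/andP => [[s [t []]] | [le_c yz]].
- by rewrite mem_filter !mem_iota => s_lt /andP[st t_lt] [-> ->]; lia.
- exists (y + z)%N, z; rewrite mem_filter !mem_iota addnK.
  by split=> //; lia.
Qed.

Lemma balanced_pairs_uniq c : uniq (balanced_pairs c).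
Proof.
apply: allpairs_uniq_dep => [|s _|]; first exact: iota_uniq.
- exact/filter_uniq/iota_uniq.
- move=> _ _ /allpairsPdep[s [z [_ + ->]]] /allpairsPdep[t [u [_ + ->]]].
  rewrite !mem_filter !mem_iota /= => sz tu [e1 e2].
  have es : s = t by lia.
  by rewrite es e2.
Qed.

Lemma count_iota_mod3 r n : (r < 3)%N ->
  count (fun z => z %% 3 == r)%N (iota 0 n) = ((n + 2 - r) %/ 3)%N.
Proof.
move=> r_lt3; elim: n => [|n IHn]; first by rewrite /=; lia.
by rewrite -(addn1 n) iotaD count_cat IHn /=; lia.
Qed.

(** As y = s - z, the congruence y = z says that z = 2 s modulo 3. *)
Lemma size_balanced_diagonal s :
  size (balanced_diagonal s) = ((s + 3 - (2 * s) %% 3) %/ 3)%N.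
Proof.
rewrite size_filter (_ : (s + 3 = s.+1 + 2)%N); last by lia.
rewrite -count_iota_mod3; last by rewrite ltn_mod.
apply: eq_in_count => z; rewrite mem_iota add0n ltnS => z_le.
have [y ->] : exists y, s = (y + z)%N by exists (s - z)%N; rewrite subnK.
by rewrite addnK; move: (z : nat) => {z_le}z; apply/eqP/eqP; lia.
Qed.

(** Three times the size of the diagonal y + z = s is
    s + 1 + 2 [3 | s] - 2 [3 | s - 1], and the sum over s <= c telescopes. *)
Lemma size_balanced_pairs c :
  (6 * size (balanced_pairs c) = c.+1 * c.+2 + 4 * (3 %| c))%N.
Proof.
rewrite size_allpairs_dep.
elim: c => [//|c IHc].
rewrite -(addn1 c.+1) iotaD map_cat sumn_cat mulnDr IHc /=.
by rewrite size_balanced_diagonal; nia.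
Qed.

(** * Counting *)

Lemma number_of_seq (T : choiceType) (s : seq T) (A : set T) :
  uniq s -> (forall x, A x <-> x \in s) -> finite_set A /\ number_of A = size s.
Proof.
move=> s_uniq As.
have -> : A = [set` [fset x in s]%fset].
  by apply/seteqP; split=> x /=; rewrite in_fset As.
split; first exact: finite_fset.
by rewrite /number_of set_fsetK card_fseq undup_id.
Qed.

Definition config_of_pair (c : nat) (p : nat * nat) : {ffun 'I_3 -> int} :=
  config (c%:Z - p.1%:Z - p.2%:Z) p.1 p.2.

Lemma config_of_pair_inj c : injective (config_of_pair c).
Proof.
move=> [y z] [y' z'] /ffunP eqC.
by move: (eqC v1) (eqC v2); rewrite !configE /= => -[->] [->].
Qed.

Lemma debt_reachableP c C' :
  debt_reachable C3 (initial c) C' <->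
  C' \in [seq config_of_pair c p | p <- balanced_pairs c].
Proof.
rewrite initialE; split.
- rewrite (config_eta C'); move: (C' v0) (C' v1) (C' v2) => x y z.
  move=> [_ /chip_config_config[x_ge0 y_ge0 z_ge0] /general_moves_invariant[]].
  rewrite !configE => sum_c [q yz].
  apply/mapP; exists (`|y|%N, `|z|%N); first by rewrite mem_balanced_pairs; lia.
  by rewrite /config_of_pair /=; congr config; lia.
- move=> /mapP[[y z]]; rewrite mem_balanced_pairs => /andP[le_c /eqP yz] ->.
  rewrite /config_of_pair /=; split; first exact/chip_config_config.
    by apply/chip_config_config; split; lia.
  have -> : c%:Z - y%:Z - z%:Z = (c - y - z)%N by lia.
  have {1}-> : c = (c - y - z + y + z)%N by lia.
  exact: general_moves_complete.
Qed.

(** The first coordinate of [config_of_pair c p] is c - p.1 - p.2, so this is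
    [occupied] read on pairs with p.1 + p.2 <= c. *)
Definition occupied_pair (c : nat) (p : nat * nat) : bool :=
  (p.1 + p.2 < c)%N || (0 < p.1)%N && (0 < p.2)%N.

Lemma reachableP c C' : (0 < c)%N ->
  reachable C3 (initial c) C' <->
  C' \in [seq config_of_pair c p | p <- balanced_pairs c & occupied_pair c p].
Proof.
move=> c_gt0; split.
- move=> [C_ge0 C'_ge0 moves].
  have : debt_reachable C3 (initial c) C'.
    by split=> //; apply: legal_moves_general.
  move=> /debt_reachableP/mapP[[y z] yz def_C'].
  apply/mapP; exists (y, z) => //; rewrite mem_filter yz andbT.
  have [|_] := legal_moves_occupied moves C_ge0.
    by left; rewrite initialE configE; lia.
  by rewrite def_C' /occupied /occupied_pair !configE /=; lia.
- move=> /mapP[[y z]]; rewrite mem_filter mem_balanced_pairs /occupied_pair /=.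
  move=> /andP[occ /andP[le_c /eqP yz]] ->; rewrite initialE /config_of_pair /=.
  split; first exact/chip_config_config.
    by apply/chip_config_config; split; lia.
  have -> : c%:Z - y%:Z - z%:Z = (c - y - z)%N by lia.
  have {1}-> : c = (c - y - z + y + z)%N by lia.
  by apply: legal_moves_complete; lia.
Qed.

Lemma size_occupied_pairs c : (0 < c)%N ->
  (size [seq p <- balanced_pairs c | occupied_pair c p] + 2 * (3 %| c) =
   size (balanced_pairs c))%N.
Proof.
move=> c_gt0; have [dvd3|ndvd3] := boolP (3 %| c)%N.
- rewrite muln1 addn2.
  have /perm_size <- // : perm_eq ((c, 0%N) :: (0%N, c) ::
      [seq p <- balanced_pairs c | occupied_pair c p]) (balanced_pairs c).
  apply: uniq_perm => [||[y z]]; last 1 first.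
  + rewrite mem_balanced_pairs !in_cons mem_filter mem_balanced_pairs.
    rewrite /occupied_pair !xpair_eqE /=.
    by move: (y : nat) (z : nat) => {}y {}z; lia.
  + rewrite !cons_uniq filter_uniq ?balanced_pairs_uniq // in_cons !mem_filter.
    by rewrite /occupied_pair xpair_eqE /=; lia.
  + exact: balanced_pairs_uniq.
- rewrite muln0 addn0; congr size; apply/all_filterP/allP => -[y z].
  by rewrite mem_balanced_pairs /occupied_pair /=; lia.
Qed.

Theorem theorem3p3 (c : nat) (hc : (0 < c)%N) :
  let R := reachable_set C3 (initial c) in
  let D := debt_reachable_set C3 (initial c) in
  finite_set R /\ finite_set D /\
  (~~ (3 %| c)%N -> number_of R = number_of D) /\
  ((3 %| c)%N -> (number_of R)%:Z = (number_of D)%:Z - 2) /\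
  (forall k : int,
    [/\ c%:Z = 3 * k ->
          (number_of R)%:R = (3 * k%:~R ^+ 2 + 3 * k%:~R - 2) / 2 :> rat,
        c%:Z = 3 * k + 1 ->
          (number_of R)%:R = (3 * k%:~R ^+ 2 + 5 * k%:~R + 2) / 2 :> rat
      & c%:Z = 3 * k + 2 ->
          (number_of R)%:R = (3 * k%:~R ^+ 2 + 7 * k%:~R + 4) / 2 :> rat]).
Proof.
move=> R D.
have map_uniq_config s : uniq s -> uniq (map (config_of_pair c) s).
  by move=> s_uniq; rewrite map_inj_uniq //; apply: config_of_pair_inj.
have [finR cardR] : finite_set R /\
    number_of R = size [seq p <- balanced_pairs c | occupied_pair c p].
  rewrite -(size_map (config_of_pair c)); apply: number_of_seq => [|C'].
    exact/map_uniq_config/filter_uniq/balanced_pairs_uniq.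
  exact: reachableP.
have [finD cardD] : finite_set D /\ number_of D = size (balanced_pairs c).
  rewrite -(size_map (config_of_pair c)); apply: number_of_seq => [|C'].
    exact/map_uniq_config/balanced_pairs_uniq.
  exact: debt_reachableP.
have := size_occupied_pairs hc; have := size_balanced_pairs c.
rewrite -cardR -cardD => eqD eqR.
split=> //; split=> //; split; first by lia.
split=> [dvd3|k]; first by lia.
have ratR n : 2 * (number_of R)%:Z = n ->
    (number_of R)%:R = n%:~R / 2 :> rat.
  by move=> <-; rewrite rmorphM /= -pmulrn mulrAC divff ?mul1r.
split=> def_c.
- rewrite (ratR (3 * k ^+ 2 + 3 * k - 2)).
    by rewrite !(rmorphB, rmorphD, rmorphM, rmorphXn).
  by nia.
- rewrite (ratR (3 * k ^+ 2 + 5 * k + 2)).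
    by rewrite !(rmorphB, rmorphD, rmorphM, rmorphXn).
  by nia.
- rewrite (ratR (3 * k ^+ 2 + 7 * k + 4)).
    by rewrite !(rmorphB, rmorphD, rmorphM, rmorphXn).
  by nia.
Qed.
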